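(* Let $(X,d)$ be a nonempty compact metric space and let $\ell:X\times X\times\mathbb R\times\mathbb R\to\mathbb R$, $(x,y,u,v)\mapsto \ell(x,y,u,v)$, be a continuous function that is $C^1$ with respect to the last two variables $(u,v)$ and such that: (1) there is a constant $\kappa_u>0$ such that $0\ge \partial_u\ell(x,y,u,v)\ge-\kappa_u$ for all $(x,y,u,v)$; (2) there is a constant $\kappa_v>0$ such that $0\ge \partial_v\ell(x,y,u,v)\ge-\kappa_v$ for all $(x,y,u,v)$; (3) $\int_{X\times X}\big(\partial_u\ell(z,x,0,0)+\partial_v\ell(z,x,0,0)\big)\,d\mu(z,x)<0$ for all Mather measures $\mu$ of $\ell_0:=\ell(\cdot,\cdot,0,0)$. Let $c_0\in\mathbb R$ be the critical constant of $\ell_0$. Then there is $\lambda_0>0$ such that for every $0<\lambda<\lambda_0$ and every $\varphi\in C^0(X,\mathbb R)$ there is a unique function $T_\lambda\varphi\in C^0(X,\mathbb R)$ such that for all $x\in X$ $$T_\lambda\varphi(x)=\min_{z\in X}\big\{\varphi(z)+\ell\big(z,x,\lambda\varphi(z),\lambda T_\lambda\varphi(x)\big)\big\}+c_0.$$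
   Context: ''$C^1$ with respect to the last two variables'' means that the partial derivatives $\partial_u\ell,\partial_v\ell$ exist everywhere and are continuous on $X\times X\times\mathbb R\times\mathbb R$. Critical constant: for a continuous $\ell_0:X\times X\to\mathbb R$, there is a unique constant $c_0\in\mathbb R$ for which there exists a continuous $u:X\to\mathbb R$ with $u(x)=\min_{y\in X}\{u(y)+\ell_0(y,x)\}+c_0$ for all $x\in X$ (this existence and uniqueness is a known theorem); $c_0$ is the critical constant of $\ell_0$. Mather measure: a Borel probability measure $\mu$ on $X\times X$ is closed if its two marginals on $X$ coincide. A Mather measure of $\ell_0$ is a closed Borel probability measure $\mu$ on $X\times X$ with $\int_{X\times X}\ell_0\,d\mu=-c_0$. *)

(* Defs.v *)
From HB Require Import structures.
From mathcomp Require Import all_boot all_order all_algebra.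
From mathcomp Require Import all_classical all_reals all_analysis.

Set Implicit Arguments.
Unset Strict Implicit.
Unset Printing Implicit Defensive.
Import Order.TTheory GRing.Theory Num.Theory.
Import numFieldNormedType.Exports.

Local Open Scope classical_set_scope.
Local Open Scope ring_scope.

(* Nonempty metric spaces: measurable types are pointed in MathComp-Analysis,
   so nonemptiness is carried by a point, which nothing below depends on. *)
#[short(type="pmetricType")]
HB.structure Definition PointedMetric (R : numDomainType) :=
  {T of Metric R T & Pointed T}.

Notation borelType T := (g_sigma_algebraType (@open T)).

Definition is_min {R : realType} (E : set R) (m : R) : Prop :=
  E m /\ lbound E m.

(* The constant c for which this holds exists and is unique when X is compact
   and l0 is continuous. *)
Definition critical_constant {R : realType} {X : pmetricType R}
    (l0 : X -> X -> R) (c : R) : Prop :=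
  exists2 u : X -> R, continuous u &
    forall x, exists2 m, is_min [set u y + l0 y x | y in [set: X]] m &
                         u x = m + c.

(* The sigma-algebra on X * X is the one generated by the open sets of the
   product topology. *)
Definition closed_measure {R : realType} {X : pmetricType R}
    (mu : probability (borelType (X * X)%type) R) : Prop :=
  forall A : set (borelType X), measurable A ->
    pushforward mu (fst : _ -> borelType X) A =
    pushforward mu (snd : _ -> borelType X) A.

Definition mather_measure {R : realType} {X : pmetricType R}
    (l0 : X -> X -> R) (mu : probability (borelType (X * X)%type) R) : Prop :=
  closed_measure mu /\
  exists2 c0, critical_constant l0 c0 &
    (\int[mu]_p (l0 p.1 p.2)%:E = (- c0)%:E)%E.

Definition partial_u {R : realType} {X : Type} (l : X -> X -> R -> R -> R)
    (x y : X) (u v : R) : R :=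
  derive1 (fun w : R => l x y w v) u.

Definition partial_v {R : realType} {X : Type} (l : X -> X -> R -> R -> R)
    (x y : X) (u v : R) : R := derive1 (l x y u) v.

Definition continuous4 {R : realType} {X : pmetricType R}
    (f : X -> X -> R -> R -> R) : Prop :=
  continuous (fun p : X * X * R * R => f p.1.1.1 p.1.1.2 p.1.2 p.2).

Definition C1_uv {R : realType} {X : pmetricType R}
    (l : X -> X -> R -> R -> R) : Prop :=
  (forall x y u v, derivable (fun w : R => l x y w v) u 1) /\
  (forall x y u v, derivable (l x y u) v 1) /\
  continuous4 (partial_u l) /\ continuous4 (partial_v l).

(* Main.v *)
Require Import Defs.
From HB Require Import structures.
From mathcomp Require Import all_boot all_order all_algebra.
From mathcomp Require Import all_classical all_reals all_analysis.

Set Implicit Arguments.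
Unset Strict Implicit.
Unset Printing Implicit Defensive.
Import Order.TTheory GRing.Theory Num.Theory.
Import numFieldNormedType.Exports.

Local Open Scope classical_set_scope.
Local Open Scope ring_scope.

(* Since l is nonincreasing in its last argument, for all z and x the equation
   t = phi z + l z x (lambda * phi z) (lambda * t) + c0 has exactly one solution
   t = tau z x, and tau is jointly continuous by monotonicity. The function
   T_lambda phi is x |-> min_z (tau z x): at t = min_z (tau z x) every right-hand
   side is at least t, with equality at a minimizer. Any lambda > 0 works, so
   lambda0 = 1 will do. *)

(** Upper and lower semicontinuity together give continuity; [tau] and its minimum over [z] are both
    handled through these two halves. *)
Lemma continuous_near_lt_gt (R : realType) (Y : topologicalType) (f : Y -> R) :
  (forall y t, f y < t -> \forall y' \near y, f y' < t) ->
  (forall y t, t < f y -> \forall y' \near y, t < f y') ->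
  continuous f.
Proof.
move=> f_lt f_gt y; apply/cvgrPdist_lt => e e0.
have lo : f y - e < f y by rewrite ltrBlDr ltrDl.
have hi : f y < f y + e by rewrite ltrDl.
near=> y'; rewrite distrC ltr_distl.
by apply/andP; split; near: y'; [exact: f_gt | exact: f_lt].
Unshelve. all: by end_near. Qed.

Lemma continuous_near_lt (R : realType) (Y : topologicalType) (f g : Y -> R) y :
  {for y, continuous f} -> {for y, continuous g} -> f y < g y ->
  \forall y' \near y, f y' < g y'.
Proof.
move=> fc gc; rewrite -subr_gt0 => fg.
have hc : {for y, continuous (fun y' => g y' - f y')} by exact: cvgB.
near=> y'; rewrite -subr_gt0; near: y'; exact: hc _ (lt_nbhsr fg).
Unshelve. all: by end_near. Qed.

Lemma continuous_at_pair (T U V : topologicalType) (f : T -> U) (g : T -> V) x :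
  {for x, continuous f} -> {for x, continuous g} ->
  {for x, continuous (fun y => (f y, g y))}.
Proof. by move=> fc gc; exact: cvg_pair fc gc. Qed.

Lemma nonincreasing_fixpoint (R : realType) (f : R -> R) :
  continuous f -> {homo f : s t /~ s <= t} -> exists t, t = f t.
Proof.
move=> fc fd.
(* Monotonicity makes [a] and [b] a bracket: [a <= 0] gives [a <= f 0 <= f a], and [0 <= b] gives
   [f b <= f 0 <= b]. So [t - f t] changes sign on [[a, b]]. *)
set a := Num.min 0 (f 0); set b := Num.max 0 (f 0).
have a0 : a <= 0 by rewrite ge_min lexx.
have b0 : 0 <= b by rewrite le_max lexx.
have fa : a <= f a by apply: le_trans _ (fd _ _ a0); rewrite ge_min lexx orbT.
have fb : f b <= b by apply: le_trans (fd _ _ b0) _; rewrite le_max lexx orbT.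
have gc : continuous (fun t : R => t - f t).
  by move=> t; apply: cvgB; [exact: cvg_id | exact: fc].
have [||t _ t0] := @IVT R (fun t => t - f t) a b 0 (le_trans a0 b0).
- exact: continuous_subspaceT.
- by rewrite ge_min le_max !subr_le0 !subr_ge0 fa fb orbT.
by exists t; apply/eqP; rewrite -subr_eq0 t0.
Qed.

(** This locates an implicitly defined [s] by testing [f] at the explicit point [t]: if [s < t] then
    [f t <= f s = s < t], while [t <= s] would give [t <= s = f s <= f t]. *)
Lemma fixpoint_lt (R : realType) (f : R -> R) (s t : R) :
  {homo f : s t /~ s <= t} -> s = f s -> (s < t) = (f t < t).
Proof.
move=> fd fs; apply/idP/idP => [st|ft].
  by apply: (le_lt_trans _ st); rewrite [leRHS]fs; exact/fd/ltW.
rewrite ltNge; apply/negP => ts.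
by have := lt_le_trans ft ts; rewrite ltNge fs fd.
Qed.

Lemma fixpoint_gt (R : realType) (f : R -> R) (s t : R) :
  {homo f : s t /~ s <= t} -> s = f s -> (t < s) = (t < f t).
Proof.
move=> fd fs; apply/idP/idP => [ts|ft].
  by apply: (lt_le_trans ts); rewrite [leLHS]fs; exact/fd/ltW.
rewrite ltNge; apply/negP => st.
by have := le_lt_trans st ft; rewrite ltNge fs fd.
Qed.

(** For a frozen [t], the condition [tau y < t] amounts to [h y t < t], which is open in [y]; the
    same goes for the reversed inequalities. *)
Lemma nonincreasing_fixpoint_continuous (R : realType) (Y : topologicalType)
    (h : Y -> R -> R) (tau : Y -> R) :
  (forall t, continuous (h ^~ t)) ->
  (forall y, {homo h y : s t /~ s <= t}) ->
  (forall y, tau y = h y (tau y)) ->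
  continuous tau.
Proof.
move=> hc hd tauE; apply: continuous_near_lt_gt => y t.
- rewrite (fixpoint_lt t (hd y) (tauE y)) => ht.
  have := continuous_near_lt (hc t y) (@cst_continuous _ _ t y) ht.
  by apply: filterS => y'; rewrite (fixpoint_lt t (hd y') (tauE y')).
- rewrite (fixpoint_gt t (hd y) (tauE y)) => ht.
  have := continuous_near_lt (@cst_continuous _ _ t y) (hc t y) ht.
  by apply: filterS => y'; rewrite (fixpoint_gt t (hd y') (tauE y')).
Qed.

Lemma compact_min_continuous (R : realType) (Z Y : topologicalType)
    (f : Z * Y -> R) (m : Y -> R) :
  compact [set: Z] -> continuous f ->
  (forall y, is_min [set f (z, y) | z in [set: Z]] (m y)) ->
  continuous m.
Proof.
move=> cZ fc mP; apply: continuous_near_lt_gt => y t.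
(* Upper half: a minimizer [z] at [y] still gives a value below [t] at nearby [y'], and this value
   bounds [m y'] from above. *)
- have [[z _ <-] _] := mP y => fzt.
  have fzc : {for y, continuous (fun y' => f (z, y'))}.
    apply: (@continuous_comp _ _ _ (fun y' => (z, y')) f); last exact: fc.
    by apply: continuous_at_pair; [exact: cvg_cst | exact: cvg_id].
  have := continuous_near_lt fzc (@cst_continuous _ _ t y) fzt.
  apply: filterS => y'; apply: le_lt_trans.
  by have [_] := mP y'; apply; exists z.
- move=> tm.
  (* Lower half, by the tube lemma: [t < f] holds on the slice over [y], hence by compactness of [Z]
     on all slices over a neighbourhood of [y]. As [m y'] is attained, the strict inequality passes
     to it. *)
  have /compact_near_coveringP/(_ Y (nbhs y) (fun y' z => t < f (z, y')) _) := cZ.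
  have tf (z : Z) : setT z -> \forall z' \near z & y' \near y, t < f (z', y').
    move=> _.
    have tfz : t < f (z, y).
      by apply: lt_le_trans tm _; have [_] := mP y; apply; exists z.
    have := continuous_near_lt (@cst_continuous _ _ t (z, y)) (fc (z, y)) tfz.
    by apply: filterS => -[].
  move=> /(_ tf); apply: filterS => y' ty'.
  by have [[z _ <-] _] := mP y'; exact: ty'.
Qed.

Lemma derive1_le0_nonincreasing (R : realType) (f : R -> R) :
  (forall t, derivable f t 1) -> (forall t, derive1 f t <= 0) ->
  {homo f : s t /~ s <= t}.
Proof.
move=> fD f'_le0 t s st.
apply: (@ler0_derive1_nincr R f s t) => //.
by apply: continuous_subspaceT => u; apply/differentiable_continuous/derivable1_diffP.
Qed.

(** If [z] minimizes [tau], then [tau z <= tau w = h w (tau w) <= h w (tau z)] for each [w], with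
    equality throughout at [w = z]. *)
Lemma is_min_fixpoint (R : realType) (Z : Type) (h : Z -> R -> R) (tau : Z -> R)
    (t : R) :
  (forall z, {homo h z : s t /~ s <= t}) ->
  (forall z, tau z = h z (tau z)) ->
  is_min [set tau z | z in [set: Z]] t -> is_min [set h z t | z in [set: Z]] t.
Proof.
move=> hd tauE [[z _ <-] tau_min]; split; first by exists z.
move=> _ [w _ <-]; have tau_zw : tau z <= tau w by apply: tau_min; exists w.
by apply: (le_trans tau_zw); rewrite [leLHS]tauE; exact: hd.
Qed.

(** This is the source of uniqueness. If [s < t], a minimizer [z] for [s] satisfies
    [h z t <= h z s = s < t], against the minimality of [t]. *)
Lemma is_min_fixpoint_le (R : realType) (Z : Type) (h : Z -> R -> R) (s t : R) :
  (forall z, {homo h z : s t /~ s <= t}) ->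
  is_min [set h z s | z in [set: Z]] s -> is_min [set h z t | z in [set: Z]] t ->
  t <= s.
Proof.
move=> hd [[z _ hs] _] [_ t_min]; rewrite leNgt; apply/negP => st.
have : t <= h z t by apply: t_min; exists z.
by rewrite leNgt (le_lt_trans _ st)// -[leRHS]hs hd// ltW.
Qed.

Lemma is_min_addr (R : realType) (Z : Type) (f : Z -> R) (m c : R) :
  is_min [set f z | z in [set: Z]] m <->
  is_min [set f z + c | z in [set: Z]] (m + c).
Proof.
split=> -[[z _ zm] m_min]; split.
- by exists z => //; rewrite zm.
- by move=> _ [w _ <-]; rewrite lerD2r; apply: m_min; exists w.
- by exists z => //; exact: addIr zm.
- by move=> _ [w _ <-]; rewrite -(lerD2r c); apply: m_min; exists w.
Qed.

Theorem proposition0p1 (R : realType) (X : pmetricType R)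
  (compactX : compact [set: X])
  (l : X -> X -> R -> R -> R)
  (l_cont : continuous4 l)
  (l_C1 : C1_uv l)
  (l_u : exists2 kappa_u : R, 0 < kappa_u &
    forall x y u v, - kappa_u <= partial_u l x y u v <= 0)
  (l_v : exists2 kappa_v : R, 0 < kappa_v &
    forall x y u v, - kappa_v <= partial_v l x y u v <= 0)
  (l_mather : forall mu : probability (borelType (X * X)%type) R,
    mather_measure (fun x y => l x y 0 0) mu ->
    (\int[mu]_p (partial_u l p.1 p.2 0 0 + partial_v l p.1 p.2 0 0)%:E < 0)%E)
  (c0 : R)
  (hc0 : critical_constant (fun x y => l x y 0 0) c0) :
  exists2 lambda0 : R, 0 < lambda0 &
    forall lambda : R, 0 < lambda < lambda0 ->
    forall phi : X -> R, continuous phi ->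
    exists! Tphi : X -> R, continuous Tphi /\
      forall x, exists2 m,
        is_min [set phi z + l z x (lambda * phi z) (lambda * Tphi x)
                 | z in [set: X]] m &
        Tphi x = m + c0.
Proof.
exists 1 => // lambda /andP[lambda_gt0 _] phi phi_cont.
(* Absorbing [c0] into [h] turns the equation at each [x] into a scalar one: [T x] is the minimum
   over [z] of [h x z (T x)]. *)
pose h (x z : X) (t : R) := phi z + l z x (lambda * phi z) (lambda * t) + c0.
have fixE (T : X -> R) x :
    (exists2 m, is_min [set phi z + l z x (lambda * phi z) (lambda * T x)
                         | z in [set: X]] m & T x = m + c0) <->
    is_min [set h x z (T x) | z in [set: X]] (T x).
  split=> [[m m_min Tx]|T_min].
    by rewrite [X in is_min _ X]Tx; exact: (iffLR (is_min_addr _ _ c0)) m_min.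
  exists (T x - c0); last by rewrite subrK.
  by apply: (iffRL (is_min_addr _ _ c0)); rewrite subrK.
have h_dec x z : {homo h x z : s t /~ s <= t}.
  move=> s t st; rewrite /h lerD2r lerD2l.
  have [_ [lD _]] := l_C1; have [kappa_v _ l'] := l_v.
  apply: derive1_le0_nonincreasing => [v|v|]; first exact: lD.
  - by have /andP[] := l' z x (lambda * phi z) v.
  - by rewrite ler_pM2l.
(* The triple [p] is [(z, x, t)]: the minimized variable comes first, as [compact_min_continuous]
   expects of the argument of [tau]. *)
have h_cont : continuous (fun p : X * X * R => h p.1.2 p.1.1 p.2).
  move=> p; have phip : phi q.1.1 @[q --> p] --> phi p.1.1.
    apply: (@continuous_comp _ _ _ (fun q : X * X * R => q.1.1) phi).
      by apply: (@continuous_comp _ _ _ fst fst); exact: cvg_fst.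
    exact: phi_cont.
  apply: cvgD; last exact: cvg_cst.
  apply: cvgD; first exact: phip.
  apply: (@continuous_comp _ _ _
    (fun q : X * X * R => (q.1.1, q.1.2, lambda * phi q.1.1, lambda * q.2))
    (fun q : X * X * R * R => l q.1.1.1 q.1.1.2 q.1.2 q.2)); last exact: l_cont.
  apply: continuous_at_pair; last by apply: cvgMr; exact: cvg_snd.
  apply: continuous_at_pair; last by apply: cvgMr; exact: phip.
  apply: continuous_at_pair.
    by apply: (@continuous_comp _ _ _ fst fst); exact: cvg_fst.
  by apply: (@continuous_comp _ _ _ fst snd); [exact: cvg_fst | exact: cvg_snd].
have /choice[tau tauE] (q : X * X) : exists t, t = h q.2 q.1 t.
  apply: nonincreasing_fixpoint; last exact: h_dec.
  move=> t; apply: (@continuous_comp _ _ _ (fun t => (q, t))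
    (fun p : X * X * R => h p.1.2 p.1.1 p.2)); last exact: h_cont.
  by apply: continuous_at_pair; [exact: cvg_cst | exact: cvg_id].
have tau_cont : continuous tau.
  apply: (@nonincreasing_fixpoint_continuous _ _ (fun q => h q.2 q.1) _ _ _ tauE)
    => [t q|q]; last exact: h_dec.
  apply: (@continuous_comp _ _ _ (fun q => (q, t))
    (fun p : X * X * R => h p.1.2 p.1.1 p.2)); last exact: h_cont.
  by apply: continuous_at_pair; [exact: cvg_id | exact: cvg_cst].
have /choice[T T_min] x : exists t, is_min [set tau (z, x) | z in [set: X]] t.
  have tau_x : continuous (fun z => tau (z, x)).
    move=> z; apply: (@continuous_comp _ _ _ (fun z => (z, x)) tau).
      by apply: continuous_at_pair; [exact: cvg_id | exact: cvg_cst].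
    exact: tau_cont.
  have [||z _ z_min] := @compact_EVT_min _ R (fun z => tau (z, x)) setT _ compactX.
  (* The minimum is attained because [X] is nonempty as well as compact. *)
  - by exists point.
  - exact: continuous_subspaceT.
  exists (tau (z, x)); split; first by exists z.
  by move=> _ [w _ <-]; apply: z_min; rewrite inE.
have T_fix x : is_min [set h x z (T x) | z in [set: X]] (T x).
  exact: (is_min_fixpoint (h_dec x) (fun z => tauE (z, x))).
exists T; split.
  split; last by move=> x; exact/fixE.
  exact: compact_min_continuous compactX tau_cont T_min.
move=> S [_ S_fix]; apply/funext => x.
have {}S_fix : is_min [set h x z (S x) | z in [set: X]] (S x) by exact/fixE.
(* Both [S x] and [T x] solve the scalar equation at [x], so the comparison applies in both
   directions. *)
by apply/eqP; rewrite eq_le !(is_min_fixpoint_le (h_dec x)).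
Qed.
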